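(* For every real $\alpha\neq0$, the Kendall number of the family $\mathcal{P}^\alpha$ of all $\alpha$-helicoidal curves in $\mathcal{L}$ is $3$.
   Context: $\mathcal{L}$ is the space of all oriented straight lines of $\mathbb{R}^3$, i.e. classes $[s\mapsto u+sv]$ with $u,v\in\mathbb{R}^3$, $\|v\|=1$, modulo translations of the parameter $s$. It is a 4-dimensional smooth manifold, diffeomorphic to $TS^2=\{(v,u)\in S^2\times\mathbb{R}^3\mid u\perp v\}$ via $(v,u)\mapsto[s\mapsto u+sv]$. Given $\ell\in\mathcal{L}$ with direction $v$ (unit), a point $p\in\ell$ and a unit vector $A\perp v$, put $B=A\times v$. The $\alpha$-helicoidal curve with initial ray $\ell$ and axis $t\mapsto p+tA$ is $\Gamma^\alpha_{\ell,p,A}:\mathbb{R}\to\mathcal{L}$, $\Gamma^\alpha_{\ell,p,A}(t)=[s\mapsto p+tA+s(\cos(\alpha t)v+\sin(\alpha t)B)]$. $\mathcal{P}^\alpha$ is the family of all the curves $\Gamma^\alpha_{\ell,p,A}$. Given a family $\mathcal{F}$ of curves in a smooth manifold $N$, the Kendall number of $\mathcal{F}$ is the minimum number of pieces in $\mathcal{F}$ of continuous curves in $N$ taking an initial point to a final point, both arbitrary and different; that is, the least $n$ such that any two different points of $N$ can be joined by a continuous curve that is a concatenation of at most $n$ pieces, each piece being the restriction of a curve in $\mathcal{F}$ to a compact interval. *)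

(* Defs.v *)
From HB Require Import structures.
From mathcomp Require Import all_boot all_order all_algebra.
From mathcomp Require Import all_classical all_reals all_analysis.
From mathcomp Require Import ring.

Set Implicit Arguments.
Unset Strict Implicit.
Unset Printing Implicit Defensive.

Import Order.TTheory GRing.Theory Num.Theory.
Import numFieldNormedType.Exports.

Local Open Scope classical_set_scope.
Local Open Scope ring_scope.

Section Euclidean.
Variable R : realType.
Implicit Types u v : 'rV[R]_3.

Definition dotprod u v : R := \sum_i u 0 i * v 0 i.

(* The library norm [`|u|] on row vectors is the sup norm; it is used below
   only through the topology it induces. *)
Definition enorm u : R := Num.sqrt (dotprod u u).

(* Indices are taken modulo 3 in the ring ['I_3]. *)
Definition crossprod u v : 'rV[R]_3 :=
  \row_(i < 3) (u 0 (i + 1) * v 0 (i + 2) - u 0 (i + 2) * v 0 (i + 1)).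

Definition sphere2 : set 'rV[R]_3 := [set v | enorm v = 1].

Definition rot_dir (v A : 'rV[R]_3) (th : R) : 'rV[R]_3 :=
  cos th *: v + sin th *: crossprod A v.

Lemma enorm1P u : enorm u = 1 <-> dotprod u u = 1.
Proof.
rewrite /enorm; split => [h|->]; last by rewrite sqrtr1.
rewrite -[LHS]sqr_sqrtr ?h ?expr1n//.
by apply: sumr_ge0 => i _; rewrite -expr2 sqr_ge0.
Qed.

Lemma rot_dir_unit (v A : 'rV[R]_3) (th : R) :
  sphere2 v -> sphere2 A -> dotprod A v = 0 -> sphere2 (rot_dir v A th).
Proof.
rewrite /sphere2 /= !enorm1P => hv hA hAv.
have /= hcs := cos2Dsin2 th.
suff -> : dotprod (rot_dir v A th) (rot_dir v A th) =
    cos th ^+ 2 * dotprod v v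
    + sin th ^+ 2 * (dotprod A A * dotprod v v - dotprod A v ^+ 2).
  by rewrite hv hA hAv expr0n subr0 !mulr1.
rewrite /dotprod /rot_dir !big_ord_recl !big_ord0 !mxE.
rewrite (_ : lift ord0 (lift ord0 ord0) = 2 :> 'I_3); last exact/val_inj.
rewrite (_ : lift ord0 ord0 = 1 :> 'I_3); last exact/val_inj.
rewrite (_ : ord0 = 0 :> 'I_3); last exact/val_inj.
rewrite (_ : 0 + 1 = 1 :> 'I_3); last exact/val_inj.
rewrite (_ : 0 + 2 = 2 :> 'I_3); last exact/val_inj.
rewrite (_ : 1 + 1 = 2 :> 'I_3); last exact/val_inj.
rewrite (_ : 1 + 2 = 0 :> 'I_3); last exact/val_inj.
rewrite (_ : 2 + 1 = 0 :> 'I_3); last exact/val_inj.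
rewrite (_ : 2 + 2 = 1 :> 'I_3); last exact/val_inj.
ring.
Qed.

End Euclidean.

Arguments sphere2 : clear implicits.

Section Lines.
Variable R : realType.

(* [(u, v)] stands for the unit speed parametrized line [s |-> u + s v]. *)
Definition param_line : topologicalType := ('rV[R]_3 * sphere2 R)%type.

Definition eval_line (l : param_line) (s : R) : 'rV[R]_3 :=
  l.1 + s *: \val l.2.

Definition line_equiv (l m : param_line) : bool :=
  `[< exists r : R, forall s : R, eval_line m s = eval_line l (s + r) >].

Lemma line_equiv_refl : reflexive line_equiv.
Proof. by move=> l; apply/asboolP; exists 0 => s; rewrite addr0. Qed.

Lemma line_equiv_sym : symmetric line_equiv.
Proof.
move=> l m; apply/asboolP/asboolP => -[r h]; exists (- r) => s;
  by rewrite h subrK.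
Qed.

Lemma line_equiv_trans : transitive line_equiv.
Proof.
move=> m l n /asboolP[r h] /asboolP[q k]; apply/asboolP; exists (q + r) => s.
by rewrite k h addrA.
Qed.

Canonical line_equiv_rel :=
  EquivRel line_equiv line_equiv_refl line_equiv_sym line_equiv_trans.

(* Oriented lines, with the quotient topology; this is the topology of the
   manifold TS^2 since [(u, v) |-> (v, u - <u, v> v)] has a continuous section
   and its fibres are the classes of [line_equiv]. *)
Definition oline : topologicalType :=
  quotient_topology {eq_quot line_equiv_rel}%qT.

Definition line_of (u : 'rV[R]_3) (v : sphere2 R) : oline :=
  (\pi_oline (u, v))%qT.

Definition dir (l : oline) : sphere2 R := (repr l : param_line).2.

Definition on_line (p : 'rV[R]_3) (l : oline) : Prop :=
  exists s : R, p = eval_line (repr l) s.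

Lemma line_of_eqP (u u' : 'rV[R]_3) (v v' : sphere2 R) :
  line_of u v = line_of u' v' <->
  exists r : R, forall s : R, u' + s *: \val v' = u + (s + r) *: \val v.
Proof. by split=> [/eqquotP/asboolP|h] //; apply/eqquotP/asboolP. Qed.

Lemma line_equiv_dir (l m : param_line) : line_equiv l m -> l.2 = m.2.
Proof.
move=> /asboolP[r h]; apply/val_inj.
have h0 := h 0; have h1 := h 1; move: h0 h1; rewrite /eval_line.
rewrite scale0r addr0 add0r scale1r => ->.
rewrite scalerDl scale1r (addrC (\val l.2)) addrA => e.
by apply: esym; apply: addrI e.
Qed.

Lemma dir_line_of (u : 'rV[R]_3) (v : sphere2 R) : dir (line_of u v) = v.
Proof. by rewrite /dir /line_of; case: piP => m /eqquotP/line_equiv_dir. Qed.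

Lemma on_line_of (p u : 'rV[R]_3) (v : sphere2 R) :
  on_line p (line_of u v) <-> exists s : R, p = u + s *: \val v.
Proof.
rewrite /on_line /line_of; case: piP => m /eqquotP; rewrite /= => /asboolP[r h].
split=> -[s ->]; first by exists (s + r); rewrite h.
by exists (s - r); rewrite h subrK.
Qed.

End Lines.

Section Helicoids.
Variables (R : realType) (alpha : R).

Definition helicoid (l : oline R) (p : 'rV[R]_3) (A : sphere2 R)
    (hA : dotprod (\val A) (\val (dir l)) = 0) (t : R) : oline R :=
  line_of (p + t *: \val A)
    (exist _ (rot_dir (\val (dir l)) (\val A) (alpha * t))
       (mem_set (rot_dir_unit _ (set_valP (dir l)) (set_valP A) hA))).

Definition helicoidal_family : set (R -> oline R) :=
  [set g | exists (l : oline R) (p : 'rV[R]_3) (A : sphere2 R)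
             (hA : dotprod (\val A) (\val (dir l)) = 0),
             on_line p l /\ g = helicoid p hA].

End Helicoids.

Section Kendall.
Variables (R : realType) (N : topologicalType) (F : set (R -> N)).

(* [c], on [[t 0, t k]], is the concatenation of its [k] restrictions to the
   [[t i, t i.+1]], each of which is, after a translation of the parameter,
   the restriction of a curve of [F] to a compact interval. *)
Definition joined_in (n : nat) (x y : N) : Prop :=
  exists (k : nat) (t : nat -> R) (c : R -> N),
    [/\ (k <= n)%N,
        forall i, (i < k)%N -> t i <= t i.+1,
        {within `[t 0%N, t k], continuous c},
        c (t 0%N) = x /\ c (t k) = y &
        forall i, (i < k)%N -> exists2 g, F g &
          exists d : R, {in `[t i, t i.+1], forall s, c s = g (s + d)}].

Definition joins_all (n : nat) : Prop :=
  forall x y : N, x <> y -> joined_in n x y.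

Definition is_kendall_number (n : nat) : Prop :=
  joins_all n /\ forall m, joins_all m -> (n <= m)%N.

End Kendall.

(* Main.v *)
Require Import Defs.
From mathcomp Require Import all_boot all_order all_algebra.
From mathcomp Require Import all_classical all_reals all_analysis.
From mathcomp Require Import ring lra.

(* A piece turns the direction [v] of a line around an axis [A] orthogonal to
   [v], translates along [A], and may use any point of the line as its base,
   which amounts to sliding along [v] for free.  If [v] and [w] are independent,
   the two quarter turns [v -> n -> w] with [n] normal to both leave free slides
   along [v], [n] and [w], hence two pieces reach every line of direction [w];
   if [v] and [w] are parallel, a first quarter turn reduces to this case.
   On the other hand a line and its opposite are not joined by two pieces: the
   translations would have to cancel, and then so would the rotations. *)

Import Order.TTheory GRing.Theory Num.Theory numFieldNormedType.Exports.

Local Open Scope classical_set_scope.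
Local Open Scope ring_scope.

(** * Dot and cross products, unit directions and rotations in three-space *)

Section Vectors.
Context {R : realType}.
Implicit Types u v w : 'rV[R]_3.

Lemma dotprodE u v :
  dotprod u v = u 0 0 * v 0 0 + u 0 1 * v 0 1 + u 0 2 * v 0 2.
Proof.
rewrite /dotprod !big_ord_recl big_ord0 addr0 addrA.
by congr (_ * _ + _ * _ + _ * _); congr (_ _); exact/val_inj.
Qed.

Lemma crossprod0 u v :
  crossprod u v 0 0 = u 0 1 * v 0 2 - u 0 2 * v 0 1.
Proof.
by rewrite mxE; congr (u _ _ * v _ _ - u _ _ * v _ _); exact/val_inj.
Qed.

Lemma crossprod1 u v :
  crossprod u v 0 1 = u 0 2 * v 0 0 - u 0 0 * v 0 2.
Proof.
by rewrite mxE; congr (u _ _ * v _ _ - u _ _ * v _ _); exact/val_inj.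
Qed.

Lemma crossprod2 u v :
  crossprod u v 0 2 = u 0 0 * v 0 1 - u 0 1 * v 0 0.
Proof.
by rewrite mxE; congr (u _ _ * v _ _ - u _ _ * v _ _); exact/val_inj.
Qed.

Definition coordE := (dotprodE, crossprod0, crossprod1, crossprod2).

Lemma rV3P u v :
  u 0 0 = v 0 0 -> u 0 1 = v 0 1 -> u 0 2 = v 0 2 -> u = v.
Proof.
move=> h0 h1 h2; apply/rowP; case; case=> [|[|[|//]]] lti.
- by rewrite (_ : Ordinal lti = 0)//; exact/val_inj.
- by rewrite (_ : Ordinal lti = 1)//; exact/val_inj.
- by rewrite (_ : Ordinal lti = 2)//; exact/val_inj.
Qed.

Lemma dotprodC u v : dotprod u v = dotprod v u.
Proof. by rewrite !dotprodE; ring. Qed.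

Lemma dotprodDl u v w : dotprod (u + v) w = dotprod u w + dotprod v w.
Proof. by rewrite !dotprodE !mxE; ring. Qed.

Lemma dotprodZl (a : R) u v : dotprod (a *: u) v = a * dotprod u v.
Proof. by rewrite !dotprodE !mxE; ring. Qed.

Lemma dotprodNl u v : dotprod (- u) v = - dotprod u v.
Proof. by rewrite !dotprodE !mxE; ring. Qed.

Lemma dotprodDr u v w : dotprod u (v + w) = dotprod u v + dotprod u w.
Proof. by rewrite !dotprodE !mxE; ring. Qed.

Lemma dotprodZr (a : R) u v : dotprod u (a *: v) = a * dotprod u v.
Proof. by rewrite !dotprodE !mxE; ring. Qed.

Lemma dotprodNr u v : dotprod u (- v) = - dotprod u v.
Proof. by rewrite !dotprodE !mxE; ring. Qed.

Lemma dotprodr0 u : dotprod u 0 = 0.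
Proof. by rewrite !dotprodE !mxE; ring. Qed.

Definition dotE := (dotprodDl, dotprodZl, dotprodNl, dotprodDr, dotprodZr,
  dotprodNr, dotprodr0).

Lemma dotprod_crossl u v : dotprod u (crossprod u v) = 0.
Proof. by rewrite !coordE; ring. Qed.

Lemma dotprod_crossr u v : dotprod v (crossprod u v) = 0.
Proof. by rewrite !coordE; ring. Qed.

Lemma crossprod_sqr u v :
  dotprod (crossprod u v) (crossprod u v) =
  dotprod u u * dotprod v v - dotprod u v ^+ 2.
Proof. by rewrite !coordE; ring. Qed.

Lemma double_crossprod u v w :
  crossprod u (crossprod v w) = dotprod u w *: v - dotprod u v *: w.
Proof. by apply: rV3P; rewrite !(coordE, mxE); ring. Qed.

Lemma crossprodC u v : crossprod u v = - crossprod v u.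
Proof. by apply: rV3P; rewrite !(coordE, mxE); ring. Qed.

Lemma crossprodZl (a : R) u v : crossprod (a *: u) v = a *: crossprod u v.
Proof. by apply: rV3P; rewrite !(coordE, mxE); ring. Qed.

Lemma crossprodZr (a : R) u v : crossprod u (a *: v) = a *: crossprod u v.
Proof. by apply: rV3P; rewrite !(coordE, mxE); ring. Qed.

Lemma crossprodDr u v w : crossprod u (v + w) = crossprod u v + crossprod u w.
Proof. by apply: rV3P; rewrite !(coordE, mxE); ring. Qed.

Lemma crossprodr0 u : crossprod u 0 = 0.
Proof. by apply: rV3P; rewrite !(coordE, mxE); ring. Qed.

Lemma dotprod_ge0 u : 0 <= dotprod u u.
Proof. by rewrite dotprodE -!expr2 !addr_ge0 ?sqr_ge0. Qed.

Lemma dotprod_eq0 u : (dotprod u u == 0) = (u == 0).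
Proof.
apply/eqP/eqP => [|->]; last by rewrite dotprodE !mxE; ring.
rewrite dotprodE -!expr2 => /eqP.
rewrite !paddr_eq0 ?addr_ge0 ?sqr_ge0// !sqrf_eq0 => /andP[/andP[]].
by move=> /eqP h0 /eqP h1 /eqP h2; apply: rV3P; rewrite mxE.
Qed.

(** Cramer's rule in the basis [u], [v], [n], cleared of its denominator so that it becomes a
    polynomial identity. It later splits a displacement into slides along three directions. *)
Lemma cramer3 u v w : let n := crossprod u v in
  dotprod n n *: w = dotprod (crossprod w v) n *: u
    + dotprod (crossprod u w) n *: v + dotprod w n *: n.
Proof. by move=> n; apply: rV3P; rewrite !(coordE, mxE); ring. Qed.

Definition mk_dir u (hu : sphere2 R u) : sphere2 R := exist _ u (mem_set hu).

Lemma unit_dir u : u != 0 -> exists2 V : sphere2 R,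
  \val V = (enorm u)^-1 *: u & 0 < enorm u.
Proof.
move=> u0; have nu : 0 < enorm u.
  by rewrite /enorm sqrtr_gt0 lt_def dotprod_eq0 u0 dotprod_ge0.
have hu : sphere2 R ((enorm u)^-1 *: u).
  apply/enorm1P; rewrite !dotE -[dotprod u u]sqr_sqrtr ?dotprod_ge0//.
  by rewrite -/(enorm u); field; rewrite gt_eqF.
by exists (mk_dir _ hu).
Qed.

Lemma dir_unit (V : sphere2 R) : dotprod (\val V) (\val V) = 1.
Proof. exact/enorm1P/(set_valP V). Qed.

Lemma orthogonal_dir (V : sphere2 R) :
  exists W : sphere2 R, dotprod (\val V) (\val W) = 0.
Proof.
suff [u u0 uV] : exists2 u : 'rV[R]_3, u != 0 & dotprod (\val V) u = 0.
  by have [W eW _] := unit_dir _ u0; exists W; rewrite eW dotprodZr uV mulr0.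
set v := \val V.
(* The vector (-v_1, v_0, 0) is orthogonal to [v], but it may vanish when v_0 = 0; in that case the
   first basis vector is orthogonal to [v]. *)
have [v0|v0] := eqVneq (v 0 0) 0.
  exists (\row_i [:: 1; 0; 0]`_i).
    apply/eqP => /rowP/(_ 0); rewrite !mxE/= => /eqP.
    by rewrite oner_eq0.
  by rewrite dotprodE !mxE/= v0; ring.
exists (\row_i [:: - v 0 1; v 0 0; 0]`_i).
  apply/eqP => /rowP/(_ 1); rewrite !mxE/= => /eqP.
  by rewrite (negbTE v0).
by rewrite dotprodE !mxE/=; ring.
Qed.

Lemma rot_dir0 u v : rot_dir u v 0 = u.
Proof. by rewrite /rot_dir cos0 sin0 scale1r scale0r addr0. Qed.

(** Since A x (A x u) = -u, the map A x _ is a quarter turn of the plane orthogonal to [A], and the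
    addition formulas apply. *)
Lemma rot_dirD u A (s t : R) : dotprod A A = 1 -> dotprod A u = 0 ->
  rot_dir u A (s + t) = rot_dir (rot_dir u A s) A t.
Proof.
move=> AA Au; rewrite /rot_dir cosD sinD crossprodDr !crossprodZr.
rewrite double_crossprod AA Au scale0r scale1r sub0r.
by apply: rV3P; rewrite !(coordE, mxE); ring.
Qed.

Lemma dotprod_rot_axis u A (s : R) :
  dotprod A u = 0 -> dotprod A (rot_dir u A s) = 0.
Proof. by move=> Au; rewrite /rot_dir !dotE Au dotprod_crossl; ring. Qed.

End Vectors.

(** * Appending a piece to a concatenation, and cutting one into pieces *)

Section Joining.
Context {R : realType} {N : topologicalType} {F : set (R -> N)}.

Lemma joined_in0 x : joined_in F 0 x x.
Proof.
exists 0%N, (fun=> 0), (fun=> x); split=> //.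
by apply: continuous_subspaceT => ?; exact: cvg_cst.
Qed.

Lemma joined_in_le m n x y : (m <= n)%N -> joined_in F m x y ->
  joined_in F n x y.
Proof.
move=> mn [k [t [c [km tS cc cxy cF]]]]; exists k, t, c; split=> //.
exact: leq_trans mn.
Qed.

Lemma joined_in_rcons n x g a b : F g -> continuous g -> a <= b ->
  joined_in F n x (g a) -> joined_in F n.+1 x (g b).
Proof.
move=> Fg cg ab [k [t [c [kn tS cc [cx cy] cF]]]].
have tk i : (i <= k)%N -> t i <= t k.
  move=> ik; rewrite -(subnKC ik); have := leqnn k; rewrite -{1}(subnKC ik).
  elim: (k - i)%N => [|j IH] ijk; first by rewrite addn0.
  by rewrite addnS in ijk *; exact: le_trans (IH (ltnW ijk)) (tS _ ijk).
(* The new piece is [g] on [a, b], shifted to start at time [t k]; the two branches of [c'] agree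
   there because [c (t k) = g a]. *)
pose t' i := if (i <= k)%N then t i else t k + (b - a).
pose c' s := if s <= t k then c s else g (s - t k + a).
have c'r s : t k <= s -> c' s = g (s - t k + a).
  rewrite /c' le_eqVlt => /orP[/eqP <-|ts]; last by rewrite leNgt ts.
  by rewrite lexx subrr add0r.
have t'k : t' k = t k by rewrite /t' leqnn.
have t'S : t' k.+1 = t k + (b - a) by rewrite /t' ltnn.
exists k.+1, t', c'; split=> //.
- move=> i; rewrite ltnS leq_eqVlt => /orP[/eqP ->|ik].
    by rewrite t'k t'S lerDl subr_ge0.
  by rewrite /t' (ltnW ik) ik; exact: tS.
- rewrite t'S {1}/t' /=.
  have -> : `[t 0%N, t k + (b - a)]%classic =
            `[t 0%N, t k] `|` `[t k, t k + (b - a)].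
    apply/seteqP; split => s /=; rewrite !in_itv /=.
      case/andP => -> -> /=; rewrite andbT.
      by case: (leP s (t k)) => [|/ltW]; [left|right].
    case=> /andP[h1 h2].
      by rewrite h1 (le_trans h2)// lerDl subr_ge0.
    by rewrite h2 (le_trans (tk _ (leq0n k)) h1).
  (* Continuity is pasted along two closed intervals, on each of which [c'] equals a continuous
     function. *)
  apply: withinU_continuous; try exact: itv_closed.
    apply: subspace_eq_continuous cc => s.
    rewrite inE /= in_itv /= => /andP[_ st].
    by rewrite /from_subspace /c' st.
  apply: (@subspace_eq_continuous _ _ _ (fun s => g (s - t k + a))).
    move=> s; rewrite inE /= in_itv /= => /andP[ts _].
    by rewrite /from_subspace c'r.
  apply: continuous_subspaceT => s.
  apply: (@continuous_comp _ _ _ (fun s => s - t k + a) g); last exact: cg.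
  by apply: cvgD; [apply: cvgB; [exact: cvg_id|exact: cvg_cst]|exact: cvg_cst].
- split; first by rewrite {1}/t' /= /c' tk.
  by rewrite t'S c'r ?lerDl ?subr_ge0//; congr g; ring.
- move=> i; rewrite ltnS leq_eqVlt => /orP[/eqP ->|ik].
    exists g => //; exists (a - t k) => s; rewrite t'k in_itv /= => /andP[ts _].
    by rewrite c'r//; congr g; ring.
  have [h Fh [d hd]] := cF _ ik; exists h => //; exists d => s.
  rewrite /t' ik (ltnW ik) => si; rewrite -hd// /c'.
  by move: si; rewrite in_itv /= => /andP[_ /le_trans ->]//; exact: tk.
Qed.

(** What a piece retains at its two ends, which is all that the lower bound uses. *)
Definition linked x y := exists g a b, [/\ F g, x = g a & y = g b].

Lemma joined_in2 x y : x <> y -> joined_in F 2 x y ->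
  exists z, linked x z /\ linked z y.
Proof.
move=> xy [k [t [c [k2 tS _ [cx cy] cF]]]].
have piece i : (i < k)%N -> linked (c (t i)) (c (t i.+1)).
  move=> ik; have [g Fg [d hd]] := cF _ ik.
  exists g, (t i + d), (t i.+1 + d); split=> //; apply: hd.
    by rewrite in_itv /= lexx tS.
  by rewrite in_itv /= lexx tS.
case: k k2 tS cy cF piece => [|[|[|//]]] _ tS cy cF piece.
- by case: xy; rewrite -cx -cy.
(* A single piece is completed by a degenerate one that stays at its final point. *)
- exists (c (t 1%N)); rewrite -cx -cy; split; first exact: piece.
  have [g [a [b [Fg _ gb]]]] := piece 0%N isT.
  by exists g, b, b.
- by exists (c (t 1%N)); rewrite -cx -cy; split; exact: piece.
Qed.

End Joining.

(** * Helicoidal pieces: three always suffice, two do not join opposite lines *)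

Section Helicoids.
Context {R : realType}.
Variables (alpha : R) (halpha : alpha <> 0).

Lemma line_of_eq (u u' : 'rV[R]_3) (V V' : sphere2 R) (r : R) :
  u' = u + r *: \val V -> \val V = \val V' -> line_of u V = line_of u' V'.
Proof.
move=> -> /val_inj <-; apply/line_of_eqP; exists r => s.
by rewrite scalerDl addrAC addrA.
Qed.

Lemma helicoid_continuous (l : oline R) p (A : sphere2 R)
    (hA : dotprod (\val A) (\val (dir l)) = 0) :
  continuous (helicoid alpha p hA).
Proof.
have c1 : continuous (fun t : R => p + t *: \val A).
  by move=> t; apply: cvgD; [exact: cvg_cst|apply: cvgZr_tmp; exact: cvg_id].
pose rot t : sphere2 R := mk_dir _
  (rot_dir_unit (alpha * t) (set_valP (dir l)) (set_valP A) hA).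
have c2 : continuous rot.
  (* The sphere has the initial topology of its inclusion, so continuity is checked on vectors. *)
  apply: continuous_comp_initial => t.
  have ct : alpha * s @[s --> t] --> alpha * t.
    by apply: cvgM; [exact: cvg_cst|exact: cvg_id].
  apply: cvgD; apply: cvgZr_tmp.
  - apply: (cvg_comp _ _ ct); exact: continuous_cos.
  - apply: (cvg_comp _ _ ct); exact: continuous_sin.
move=> t.
have c12 : {for t,
    continuous (fun t : R => (p + t *: \val A, rot t) : param_line R)}.
  exact: (cvg_pair (c1 t) (c2 t)).
exact: (continuous_comp c12 (@pi_continuous (param_line R) _ _)).
Qed.

(** Restarting the curve at its first endpoint leaves only the parameter difference [t], which fixes
    both translation and angle; [r] and [r'] absorb the choice of base points on the two lines. *)
Lemma linked_lines (u u' : 'rV[R]_3) (V V' : sphere2 R) :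
  @linked R _ (helicoidal_family alpha) (line_of u V) (line_of u' V') ->
  exists (A : 'rV[R]_3) (t r r' : R),
    [/\ dotprod A A = 1, dotprod A (\val V) = 0,
        \val V' = rot_dir (\val V) A (alpha * t) &
        u' = u + r *: \val V + t *: A + r' *: \val V'].
Proof.
case=> _ [a [b [[l [p [A [hA [_ ->]]]]] hV hV']]].
have eV : \val V = rot_dir (\val (dir l)) (\val A) (alpha * a).
  by rewrite -(dir_line_of u V) hV dir_line_of.
have eV' : \val V' = rot_dir (\val (dir l)) (\val A) (alpha * b).
  by rewrite -(dir_line_of u' V') hV' dir_line_of.
move: hV => /line_of_eqP[r /(_ 0)]; move: hV' => /line_of_eqP[r' /(_ 0)].
rewrite !scale0r !addr0 !add0r => eb ea.
exists (\val A), (b - a), r, (- r').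
have AA := dir_unit A; split=> //.
- by rewrite eV dotprod_rot_axis.
- by rewrite eV -rot_dirD// eV'; congr (rot_dir _ _ _); ring.
- have -> : u + r *: \val V = p + a *: \val A by rewrite ea.
  have -> : u' = p + b *: \val A - r' *: \val V' by rewrite eb addrK.
  rewrite scaleNr scalerBl; congr (_ - _); rewrite -addrA; congr (_ + _).
  by rewrite addrC subrK.
Qed.

(* Curves are run in the direction of increasing parameter, so the axis is
   reversed when [alpha < 0], whence the factor [Num.sg alpha] in the proof. *)
Lemma joined_in_quarter n x (p : 'rV[R]_3) (V W : sphere2 R) (s : R) :
  dotprod (\val V) (\val W) = 0 ->
  joined_in (helicoidal_family alpha) n x (line_of p V) ->
  joined_in (helicoidal_family alpha) n.+1 x
    (line_of (p + s *: \val V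
              + (pi / 2 / alpha) *: crossprod (\val V) (\val W)) W).
Proof.
move=> VW jx; have a0 : alpha != 0 by exact/eqP.
have sg2 : Num.sg alpha * Num.sg alpha = 1 by rewrite -expr2 sqr_sg a0.
pose A := Num.sg alpha *: crossprod (\val V) (\val W).
have Au : sphere2 R A.
  apply/enorm1P; rewrite !dotE crossprod_sqr !dir_unit VW mulrA sg2; ring.
pose SA := mk_dir _ Au.
have hA : dotprod (\val SA) (\val (dir (line_of p V))) = 0.
  by rewrite dir_line_of dotE dotprodC dotprod_crossl mulr0.
pose g := helicoid alpha (p + s *: \val V) hA.
have g0 : g 0 = line_of p V.
  apply/esym/(@line_of_eq _ _ _ _ s); first by rewrite scale0r addr0.
  by rewrite /= mulr0 rot_dir0 dir_line_of.
have gb : g (pi / 2 / `|alpha|) = line_of (p + s *: \val V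
              + (pi / 2 / alpha) *: crossprod (\val V) (\val W)) W.
  apply: (@line_of_eq _ _ _ _ 0).
    rewrite scale0r addr0; congr (_ + _); rewrite /= /A scalerA.
    congr (_ *: _); rewrite {1}[alpha]numEsg invfM -[in RHS]mulrA.
    congr (_ * _).
    by rewrite mulrC invr_sg.
  rewrite /= dir_line_of /rot_dir.
  have -> : alpha * (pi / 2 / `|alpha|) = Num.sg alpha * (pi / 2).
    by rewrite {1}[alpha]numEsg; field; rewrite normr_eq0.
  have -> : cos (Num.sg alpha * (pi / 2)) = 0 :> R.
    by have [] := sgrP alpha; rewrite ?mul1r ?mulN1r ?cosN ?cos_pihalf.
  have -> : sin (Num.sg alpha * (pi / 2)) = Num.sg alpha.
    by have [] := sgrP alpha; rewrite ?mul1r ?mulN1r ?sinN ?sin_pihalf.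
  (* The two signs cancel, and (V x W) x V = W for orthonormal [V], [W]. *)
  rewrite scale0r add0r crossprodZl scalerA sg2 scale1r crossprodC.
  by rewrite double_crossprod dir_unit VW scale0r scale1r sub0r opprK.
rewrite -gb; apply: (@joined_in_rcons _ _ _ _ _ g 0); last by rewrite g0.
- exists (line_of p V), (p + s *: \val V), SA, hA; split=> //.
  by apply/on_line_of; exists s.
- exact: helicoid_continuous.
- by rewrite !divr_ge0 ?pi_ge0.
Qed.

Lemma joined_in_independent n x (p q : 'rV[R]_3) (V W : sphere2 R) :
  crossprod (\val V) (\val W) != 0 ->
  joined_in (helicoidal_family alpha) n x (line_of p V) ->
  joined_in (helicoidal_family alpha) n.+2 x (line_of q W).
Proof.
move=> VW0; have [M eM nM] := unit_dir _ VW0.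
set m := crossprod _ _ in VW0 eM nM.
have VM : dotprod (\val V) (\val M) = 0 by rewrite eM dotE dotprod_crossl mulr0.
have MW : dotprod (\val M) (\val W) = 0.
  by rewrite eM dotE dotprodC dotprod_crossr mulr0.
set c := pi / 2 / alpha.
(* What is left of the displacement from [p] to [q] once the translations forced by the two quarter
   turns are removed. *)
pose d := q - p - c *: crossprod (\val V) (\val M)
  - c *: crossprod (\val M) (\val W).
have := cramer3 (\val V) (\val W) d; rewrite -/m => ed.
pose D := dotprod m m.
have D0 : D != 0 by rewrite dotprod_eq0.
(* Coordinates of [d] along [V], [M] and [W]; the factor [enorm m] in [r] passes from [m] to the
   unit vector [M]. The first two are slides before each piece, and [e] changes the base point of
   the final line. *)
pose s := dotprod (crossprod d (\val W)) m / D.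
pose r := dotprod d m / D * enorm m.
pose e := dotprod (crossprod (\val V) d) m / D.
move=> /(joined_in_quarter _ _ _ _ _ s VM)/(joined_in_quarter _ _ _ _ _ r MW).
rewrite -/c; congr joined_in.
apply: (@line_of_eq _ _ _ _ e) => //.
have {}ed : d = s *: \val V + e *: \val W + r *: \val M.
  apply: (scalerI D0); rewrite ed !scalerDr !scalerA.
  congr (_ *: _ + _ *: _ + _).
  - by rewrite /s; field.
  - by rewrite /e; field.
  - rewrite eM scalerA; congr (_ *: _).
    by rewrite /r; field; rewrite D0 gt_eqF.
have -> : q = p + c *: crossprod (\val V) (\val M)
  + c *: crossprod (\val M) (\val W) + d.
  rewrite /d; move: (crossprod _ _) (crossprod _ _) => X Y.
  by apply: rV3P; rewrite !mxE; ring.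
rewrite ed; move: (crossprod _ (\val M)) (crossprod (\val M) _) => X Y.
by apply: rV3P; rewrite !mxE; ring.
Qed.

Lemma joins_all_helicoids : joins_all (helicoidal_family alpha) 3.
Proof.
move=> x y _; rewrite -(reprK x) -(reprK y).
case: (repr x) (repr y) => [p V] [q W].
rewrite -/(line_of p V) -/(line_of q W).
have [VW|VW] := eqVneq (crossprod (\val V) (\val W)) 0; last first.
  apply: (@joined_in_le _ _ _ 2) => //.
  by apply: joined_in_independent VW _; exact: joined_in0.
have [U VU] := orthogonal_dir V.
have /(joined_in_quarter _ _ _ _ _ 0 VU) := @joined_in0 _ _
  (helicoidal_family alpha) (line_of p V).
apply: joined_in_independent; apply/eqP => UW.
(* If [W] were parallel to both [U] and [V], then <V,W>^2 = <U,W>^2 = 1, while <V,W> <U,W> = <U,V> =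
   0. *)
have := crossprod_sqr (\val U) (\val W).
have := crossprod_sqr (\val V) (\val W).
have := congr1 (dotprod (\val U)) (double_crossprod (\val W) (\val V) (\val W)).
rewrite UW VW crossprodr0 !dotE (dotprodC (\val U) (\val V)) VU.
rewrite !dir_unit (dotprodC (\val W)).
set a := dotprod (\val V) _; set b := dotprod (\val U) _ => hab ha hb.
by clear - hab ha hb; nra.
Qed.

(* Both axes [A], [B] are orthogonal to [E] and to the intermediate direction,
   so the translations [t], [s] along them cancel, which forces [s = t] or
   [s = - t], while the angles satisfy [cos (alpha * s) = - cos (alpha * t)]. *)
Lemma not_joined_in2_opp (E E' : sphere2 R) : \val E' = - \val E ->
  ~ joined_in (helicoidal_family alpha) 2 (line_of 0 E) (line_of 0 E').
Proof.
move=> eE jEE'; have EE := dir_unit E.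
have neqEE' : line_of 0 E <> line_of 0 E'.
  move=> /(congr1 (@dir R)); rewrite !dir_line_of => h; move: eE; rewrite -h.
  move=> /(congr1 (dotprod (\val E))); rewrite dotprodNr EE => {}h.
  by clear - h; lra.
have [z [+ +]] := joined_in2 _ _ neqEE' jEE'.
rewrite -(reprK z); case: (repr z) => [u V]; rewrite -/(line_of u V).
move=> /linked_lines[A [t [r [r' [AA AE eV eu]]]]].
move=> /linked_lines[B [s [q [q' [BB BV eE' eu']]]]].
have AV : dotprod A (\val V) = 0 by rewrite eV dotprod_rot_axis.
have BE : dotprod B (\val E) = 0.
  have : dotprod B (\val E') = 0 by rewrite eE' dotprod_rot_axis.
  by rewrite eE dotprodNr => h; clear - h; lra.
have tA : t + s * dotprod A B = 0.
  move/(congr1 (dotprod A)): eu'; rewrite eu eE !dotE AA AE AV.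
  by move=> h; clear - h; lra.
have sB : t * dotprod A B + s = 0.
  move/(congr1 (dotprod B)): eu'; rewrite eu eE !dotE BB BE BV (dotprodC B A).
  by move=> h; clear - h; lra.
have VE : dotprod (\val V) (\val E) = cos (alpha * t).
  rewrite eV /rot_dir !dotE EE [dotprod (crossprod _ _) _]dotprodC.
  by rewrite dotprod_crossr; ring.
have VE' : - dotprod (\val V) (\val E) = cos (alpha * s).
  rewrite -dotprodNr -eE eE' /rot_dir !dotE dir_unit dotprod_crossr.
  by ring.
(* Both s^2 and t^2 equal - s t <A,B>. *)
have st : (s == t) || (s == - t)
  by rewrite -eqf_sqr; apply/eqP; clear - tA sB; nra.
have ct : cos (alpha * t) = 0.
  case/orP: st => /eqP e; move: VE'; rewrite VE e ?mulrN ?cosN => h;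
    by clear - h; lra.
(* With both cosines zero, [E'] is a multiple of B x (A x E) = - <A,B> E; pairing with [E] gives
   sin(alpha s) sin(alpha t) <A,B> = 1. *)
have := congr1 (dotprod (\val E)) eE'.
have cs : cos (alpha * s) = 0 by rewrite -VE' VE ct oppr0.
rewrite eE /rot_dir cs eV /rot_dir ct !scale0r !add0r crossprodZr.
rewrite double_crossprod BE !dotE EE (dotprodC _ A) AE (dotprodC B A).
move=> hs; have := cos2Dsin2 (alpha * t); rewrite ct /= => h1.
(* If s = e t with e = 1 or -1, the sine relation forces <A,B> = e, and [tA] becomes 2 t = 0. *)
suff t0 : t = 0 by move: ct; rewrite t0 mulr0 cos0 => /eqP; rewrite oner_eq0.
have {}hs : sin (alpha * s) * sin (alpha * t) * dotprod A B = 1.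
  by clear - hs; lra.
clear - hs st tA sB h1; move: hs tA sB h1.
by case/orP: st => /eqP ->; rewrite ?mulrN ?sinN; nra.
Qed.

End Helicoids.

Theorem proposition21 (R : realType) (alpha : R) (halpha : alpha <> 0) :
  is_kendall_number (helicoidal_family alpha) 3.
Proof.
split=> [|m joins]; first exact: joins_all_helicoids.
rewrite leqNgt; apply/negP; rewrite ltnS => m2.
(* Any direction serves for the pair of opposite lines; here (1, 1, 1) is normalized. *)
have [E _ _] : exists2 E : sphere2 R, True & True.
  have : (const_mx 1 : 'rV[R]_3) != 0.
    by apply/eqP => /rowP/(_ 0); rewrite !mxE => /eqP; rewrite oner_eq0.
  by case/unit_dir => E _ _; exists E.
have hE : sphere2 R (- \val E).
  by apply/enorm1P; rewrite !dotE opprK dir_unit.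
apply: (@not_joined_in2_opp _ alpha E (mk_dir _ hE)) => //.
apply: joined_in_le m2 _; apply: joins => /(congr1 (@dir R)).
rewrite !dir_line_of.
move=> /(congr1 (fun V : sphere2 R => dotprod (\val E) (\val V))).
by rewrite /= dotE dir_unit => h; clear - h; lra.
Qed.
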